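(* Let $n\ge 1$ and let $\lambda\vdash n$ be a partition written as $\lambda=1^{j_1}2^{j_2}\cdots n^{j_n}$, where $j_i\ge 0$ denotes the number of parts of $\lambda$ equal to $i$. Let $\rho\in S_n$ be any permutation of cycle type $\lambda$, and let $$N(\lambda)=\left|\{(\sigma,\tau)\in S_n\times S_n:\ \sigma^2=\tau^2=1,\ \sigma\tau=\rho\}\right|.$$ Then $$N(\lambda)=\prod_{i=1}^n R_{j_i}(i),$$ where for integers $m\ge 0$ and $k\ge 1$, $$R_m(k)=\sum_{0\le i\le m/2}\frac{k^{m-i}\, m!}{2^i\, i!\,(m-2i)!}.$$
   Context: $S_n$ is the symmetric group on $[n]=\{1,\dots,n\}$; an involution is a permutation whose square is the identity (the identity itself included). The number $N(\lambda)$ does not depend on the choice of $\rho$ within the conjugacy class of cycle type $\lambda$. Note $R_0(k)=1$. *)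

(* Defs.v *)
From mathcomp Require Import all_boot all_order all_fingroup all_algebra.

Set Implicit Arguments.
Unset Strict Implicit.
Unset Printing Implicit Defensive.

Import GRing.Theory Num.Theory.
Local Open Scope ring_scope.

(* A partition is its weakly decreasing sequence of positive parts, so that
   j_i is count_mem i lam. *)
Definition is_partition_of (n : nat) (lam : seq nat) : bool :=
  [&& sorted geq lam, 0%N \notin lam & sumn lam == n].

(* Fixed points are orbits of size 1, hence contribute parts equal to 1. *)
Definition cycle_type (T : finType) (s : {perm T}) : seq nat :=
  sort geq [seq #|C| | C : {set T} <- enum (porbits s)].

(* The product of MathComp permutations applies the left factor first; with the
   opposite convention the set below is its image under swapping the two
   components, so the cardinal is the same. *)
Definition involution_factorizations (n : nat) (rho : 'S_n) :
    {set 'S_n * 'S_n} :=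
  [set p : 'S_n * 'S_n |
    [&& (p.1 ^+ 2 == 1)%g, (p.2 ^+ 2 == 1)%g & (p.1 * p.2 == rho)%g]].

Definition Rsum (m k : nat) : rat :=
  \sum_(0 <= i < (m./2).+1)
    (k%:R ^+ (m - i) * (m`!)%:R) / (2%:R ^+ i * (i`!)%:R * ((m - 2 * i)`!)%:R).

(* Main.v *)
Require Import Defs.
From mathcomp Require Import all_boot all_order all_fingroup all_algebra cyclic.

(** A factorization [rho = sigma tau] into involutions is the same as an
    involution [sigma] that conjugates [rho] to its inverse.  Since
    [sigma (g x) = g^-1 (sigma x)] for every power [g] of [rho], such a [sigma]
    maps the cycle of [x] onto that of [y := sigma x], which has the same
    length, and is determined by [y] on these two cycles; conversely every [y]
    whose cycle is as long as that of [x] occurs, because [x] and [y] then have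
    the same stabilizer in the cyclic group generated by [rho].  If there are
    [m + 1] cycles of the length [k] of the cycle of [x], then [y] is one of [k]
    points of that cycle, leaving [m] cycles of length [k], or one of [m k]
    points of another cycle, leaving [m - 1]; hence the recurrence
    [R_(m+1)(k) = k R_m(k) + m k R_(m-1)(k)], satisfied by the closed form. *)

Set Implicit Arguments.
Unset Strict Implicit.
Unset Printing Implicit Defensive.

Import GRing.Theory Num.Theory.

Lemma prod_odd_fact i : (\prod_(j < i) j.*2.+1) * (2 ^ i * i`!) = (i.*2)`!.
Proof.
elim: i => [|i IHi]; first by rewrite big_ord0.
rewrite big_ord_recr /= doubleS !factS expnS -IHi -(doubleS i) -(mul2n i.+1).
by rewrite [2 * _ * _]mulnACA mulnCA (mulnC _ i.*2.+1) !mulnA.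
Qed.

(* Sets of [i] disjoint pairs out of [m] points: choose the [2 i] covered points,
   then match them in one of [1 * 3 * ... * (2 i - 1)] ways. *)
Definition matching_count (m i : nat) : nat :=
  'C(m, i.*2) * \prod_(j < i) j.*2.+1.

Lemma matching_count0 m : matching_count m 0 = 1.
Proof. by rewrite /matching_count big_ord0 bin0. Qed.

Lemma matching_count_small m i : m < i.*2 -> matching_count m i = 0.
Proof. by move=> lt_mi; rewrite /matching_count bin_small. Qed.

Lemma matching_countS m i :
  matching_count m.+1 i.+1 = matching_count m i.+1 + m * matching_count m.-1 i.
Proof.
rewrite /matching_count doubleS big_ord_recr binS mulnDl; congr (_ + _).
by rewrite [RHS]mulnA mul_bin_diag mulnA mulnAC [in LHS](mulnC 'C(_, _)).
Qed.

Lemma matching_count_fact m i :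
  i.*2 <= m -> matching_count m i * (2 ^ i * i`! * (m - i.*2)`!) = m`!.
Proof.
by move=> /bin_fact <-; rewrite -prod_odd_fact /matching_count !mulnA.
Qed.

(* The terms with [2 i > m], which [Rsum] omits, vanish. *)
Definition Rsumn (m k : nat) : nat :=
  \sum_(i < m.+1) k ^ (m - i) * matching_count m i.

Lemma Rsumn0 k : Rsumn 0 k = 1.
Proof. by rewrite /Rsumn big_ord1 matching_count0. Qed.

(* For [m = 0] the junk term [Rsumn 0.-1 k] is multiplied by [0]. *)
Lemma RsumnS m k : Rsumn m.+1 k = k * (Rsumn m k + m * Rsumn m.-1 k).
Proof.
have lt_double i : i < i.+1.*2 by rewrite doubleS ltnS -addnn -addnS leq_addr.
have Rsumn_recl : Rsumn m.+1 k =
    k ^ m.+1 + \sum_(i < m.+1) k ^ (m - i) * matching_count m.+1 i.+1.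
  by rewrite /Rsumn big_ord_recl matching_count0 muln1.
rewrite {}Rsumn_recl mulnDr.
under eq_bigr => i _ do rewrite matching_countS mulnDr.
rewrite big_split /= addnA; congr (_ + _).
  rewrite big_ord_recr /= matching_count_small // muln0 addn0.
  rewrite /Rsumn big_ord_recl matching_count0 muln1 mulnDr subn0 -expnS.
  congr (_ + _); rewrite big_distrr; apply: eq_bigr => i _ /=.
  by rewrite /bump add1n mulnA -expnS subnSK.
case: m => [|m]; last first.
  rewrite big_ord_recr /= matching_count_small // !muln0 addn0 mulnCA.
  rewrite /Rsumn !big_distrr; apply: eq_bigr => i _ /=.
  have le_im : i <= m by rewrite -ltnS.
  by rewrite mulnCA subSn // expnS -mulnA.
by rewrite mul0n muln0 big1 // => i _; rewrite mul0n muln0.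
Qed.

Lemma natr_Rsumn m k : ((Rsumn m k)%:R = Rsum m k)%R.
Proof.
pose F i : rat := ((k ^ (m - i) * matching_count m i)%:R)%R.
have le_half : m./2.+1 <= m.+1.
  by rewrite ltnS leq_half_double -addnn -addnS leq_addr.
rewrite /Rsumn natr_sum -(big_mkord xpredT F).
rewrite (big_cat_nat (leq0n _) le_half) /=.
rewrite [X in (_ + X)%R]big_nat [X in (_ + X)%R]big1 => [|i /andP[lt_i _]].
  rewrite addr0 /Rsum !big_nat; apply: eq_bigr => i /=.
  rewrite ltnS geq_half_double => le_2i; rewrite /F mul2n.
  rewrite -natrX -!natrM -(matching_count_fact le_2i) -natrX -!natrM.
  rewrite mulnA [in RHS]natrM natrM.
  by rewrite mulfK // pnatr_eq0 -lt0n !muln_gt0 expn_gt0 !fact_gt0.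
by rewrite /F matching_count_small ?muln0 // -ltn_half_double.
Qed.

Lemma prod_Rsumn_rec n k (m : nat -> nat) : 0 < k <= n ->
  \prod_(1 <= i < n.+1) Rsumn (m i + (i == k)) i =
    k * (\prod_(1 <= i < n.+1) Rsumn (m i) i +
         m k * \prod_(1 <= i < n.+1) Rsumn (m i - (i == k)) i).
Proof.
move=> k_in.
have k_iota : k \in index_iota 1 n.+1 by rewrite mem_index_iota.
have split_k (m' : nat -> nat) : (forall i, i != k -> m' i = m i) ->
    \prod_(1 <= i < n.+1) Rsumn (m' i) i =
    Rsumn (m' k) k * \prod_(1 <= i < n.+1 | i != k) Rsumn (m i) i.
  move=> eq_m; rewrite (bigD1_seq k) ?iota_uniq //; congr (_ * _).
  by apply: eq_bigr => i /eq_m ->.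
rewrite split_k => [|i /negPf->]; last by rewrite addn0.
rewrite !split_k // => [|i /negPf->]; last by rewrite subn0.
by rewrite eqxx addn1 subn1 RsumnS mulnA -mulnDl mulnA.
Qed.

Lemma perm_involutive (T : finType) (s : {perm T}) :
  (s ^+ 2 = 1)%g -> involutive s.
Proof. by move=> s2 x; rewrite -permM -[(s * s)%g]/(s ^+ 2)%g s2 perm1. Qed.

Lemma mulg_involutive (gT : groupType) (g : gT) :
  (g ^+ 2 = 1)%g -> involutive (mulg g).
Proof. by move=> g2 h; rewrite mulgA -[(g * g)%g]/(g ^+ 2)%g g2 mul1g. Qed.

Section Inverters.
Variables (T : finType) (rho : {perm T}).
Implicit Types (x y z : T) (g h r s t : {perm T}) (D E F : {set T}).
Local Open Scope group_scope.

Local Notation stable D := [acts <[rho]>, on D | 'P].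

Lemma porbit_cycleP x z :
  reflect (exists2 g, g \in <[rho]> & z = g x) (z \in porbit rho x).
Proof. by rewrite porbit.unlock; apply: imsetP. Qed.

Lemma stable_porbit x : stable (porbit rho x).
Proof. by rewrite porbitE acts_orbit ?subsetT. Qed.

Lemma porbit_sub D x : stable D -> (porbit rho x \subset D) = (x \in D).
Proof. by rewrite porbitE; apply: acts_sub_orbit. Qed.

Lemma stable_perm D z : stable D -> (rho z \in D) = (z \in D).
Proof. by move/acts_act/(_ _ (cycle_id rho) z). Qed.

(* A cyclic group has at most one subgroup of each order. *)
Lemma eq_stab_porbit x y : #|porbit rho x| = #|porbit rho y| ->
  'C_<[rho]>[x | 'P] = 'C_<[rho]>[y | 'P].
Proof.
move=> eq_xy; apply/eqP.
rewrite (eq_subG_cyclic (cycle_cyclic rho)) ?subsetIl //.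
have gt0 : 0 < #|porbit rho x| by rewrite lt0n card_porbit_neq0.
rewrite -(eqn_pmul2l gt0) {2}eq_xy !porbitE.
by apply/eqP; rewrite !card_orbit_stab.
Qed.

Lemma eq_cycleV_porbit x y g h : #|porbit rho x| = #|porbit rho y| ->
  g \in <[rho]> -> h \in <[rho]> -> g x = h x -> g^-1 y = h^-1 y.
Proof.
move=> eq_xy Gg Gh eq_gh.
have : g * h^-1 \in 'C_<[rho]>[x | 'P].
  rewrite inE groupM ?groupV //.
  by apply/astab1P; rewrite /= apermE permM eq_gh permK.
rewrite (eq_stab_porbit eq_xy) => /setIP[_ /astab1P /=].
rewrite apermE => fix_y.
have <- : g * h^-1 * g^-1 = h^-1.
  by rewrite (centsP (cycle_abelian rho) g Gg) ?groupV // mulgK.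
by rewrite permM fix_y.
Qed.

Definition inverters D : {set {perm T}} :=
  [set s | [&& perm_on D s, s ^+ 2 == 1
             & [forall z in D, s (rho z) == rho^-1 (s z)]]].

Lemma invertersP D s :
  reflect [/\ perm_on D s, s ^+ 2 = 1
            & {in D, forall z, s (rho z) = rho^-1 (s z)}]
          (s \in inverters D).
Proof.
rewrite inE; apply: (iffP and3P) => [[? /eqP ? /forall_inP sV] | [? -> sV]].
  by split=> // z /sV /eqP.
by split=> //; apply/forall_inP => z /sV ->.
Qed.

Lemma mem_invertersT s :
  (s \in inverters setT) = (s ^+ 2 == 1) && ((s * rho) ^+ 2 == 1).
Proof.
have s_on : perm_on setT s by apply/subsetP.
rewrite inE s_on /=; apply: andb_id2l => s2.
have sV : s^-1 = s by apply/eqP; rewrite eq_invg_mul -[s * s]/(s ^+ 2).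
rewrite expgS expg1 -mulgA -eq_invg_mul sV eq_sym mulgA.
rewrite (can2_eq (mulgK rho) (mulgKV rho)).
apply/forall_inP/eqP => [rhos | rhos z _]; last by rewrite -!permM rhos.
by apply/permP => z; rewrite !permM; apply/eqP/rhos; rewrite inE.
Qed.

Lemma inverters0 : inverters set0 = [set 1].
Proof.
apply/setP => s; rewrite in_set1; apply/invertersP/eqP => [[s_on _ _] | ->].
  by apply: perm_on_id s_on _; rewrite cards0.
by split; [exact: perm_on1 | rewrite expg1n | move=> z; rewrite inE].
Qed.

Lemma inverters_cycle D s g z : stable D -> s \in inverters D ->
  g \in <[rho]> -> z \in D -> s (g z) = g^-1 (s z).
Proof.
move=> stD /invertersP[_ _ sV] /cycleP[i ->] zD; rewrite -expgVn.
elim: i => [|i IHi]; first by rewrite !perm1.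
rewrite !expgSr !permM sV ?IHi //.
by rewrite (acts_act stD (mem_cycle rho i)).
Qed.

Lemma imset_porbit_inverters D s x : stable D -> s \in inverters D ->
  x \in D -> s @: porbit rho x = porbit rho (s x).
Proof.
move=> stD sD xD; apply/setP => z.
apply/imsetP/porbit_cycleP => [[_ /porbit_cycleP[g Gg ->] ->] | [g Gg ->]].
  by exists g^-1; rewrite ?groupV ?(inverters_cycle stD sD).
exists (g^-1 x); last by rewrite (inverters_cycle stD sD) ?groupV ?invgK.
by apply/porbit_cycleP; exists g^-1; rewrite ?groupV.
Qed.

Lemma card_porbit_inverters D s x : stable D -> s \in inverters D ->
  x \in D -> #|porbit rho (s x)| = #|porbit rho x|.
Proof.
move=> stD sD xD; rewrite -(imset_porbit_inverters stD sD xD) card_imset //.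
exact: perm_inj.
Qed.

Lemma eq_in_inverters D E r s x : stable D -> stable E ->
    r \in inverters E -> s \in inverters D -> x \in E -> x \in D -> r x = s x ->
  {in porbit rho x :|: porbit rho (s x), r =1 s}.
Proof.
move=> stD stE rE sD xE xD eq_x.
have [/perm_closed rEE /perm_involutive rK _] := invertersP _ _ rE.
have [/perm_closed sDD /perm_involutive sK _] := invertersP _ _ sD.
move=> _ /setUP[] /porbit_cycleP[g Gg ->].
  by rewrite (inverters_cycle stE rE) // (inverters_cycle stD sD) // eq_x.
rewrite (inverters_cycle stD sD) ?sDD // sK -eq_x.
by rewrite (inverters_cycle stE rE) ?rEE // rK.
Qed.

Lemma invertersM E F r t : stable E -> stable F -> [disjoint E & F] ->
  r \in inverters E -> t \in inverters F -> r * t \in inverters (E :|: F).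
Proof.
move=> stE stF disjEF /invertersP[r_on r2 rV] /invertersP[t_on t2 tV].
have E'F z : z \in F -> z \notin E by move/(disjointFl disjEF)->.
have F'E z : z \in E -> z \notin F by move/(disjointFr disjEF)->.
apply/invertersP; split.
- by apply: perm_onM; [apply: subset_trans r_on _ | apply: subset_trans t_on _];
    rewrite ?subsetUl ?subsetUr.
- by rewrite expgMn ?r2 ?t2 ?mulg1 //; apply: perm_onC r_on t_on disjEF.
- move=> z /setUP[zE | zF]; rewrite !permM.
    by rewrite !(out_perm t_on) ?F'E ?(perm_closed _ r_on) ?stable_perm // rV.
  by rewrite !(out_perm r_on) ?E'F ?stable_perm // tV.
Qed.

(* Since [r] is an involution, [r * s] is the restriction of [s] to [F]. *)
Lemma inverters_restr E F r s : stable F -> [disjoint E & F] ->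
    r \in inverters E -> s \in inverters (E :|: F) -> {in E, s =1 r} ->
  r * s \in inverters F.
Proof.
move=> stF disjEF /invertersP[r_on /perm_involutive rK _].
move=> /invertersP[s_on /perm_involutive sK sV] eq_sr.
have E'F z : z \in F -> z \notin E by move/(disjointFl disjEF)->.
have sE z : (s z \in E) = (z \in E).
  rewrite -{1}(im_perm_on r_on) -(eq_in_imset eq_sr) mem_imset //.
  exact: perm_inj.
have rsE : {in E, r * s =1 id}.
  by move=> z zE; rewrite permM eq_sr ?rK // (perm_closed _ r_on).
have rs_out z : z \notin E -> (r * s) z = s z.
  by move=> zE; rewrite permM (out_perm r_on).
apply/invertersP; split.
- apply/subsetP => z; apply: contraR => zF.
  have [/rsE -> // | zE] := boolP (z \in E).
  by rewrite rs_out // (out_perm s_on) // inE negb_or zE.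
- apply/permP => z; rewrite perm1 expgS expg1 permM.
  have [zE | zE] := boolP (z \in E); first by rewrite !rsE.
  by rewrite !rs_out ?sK // sE.
- move=> z zF; rewrite !rs_out ?E'F ?stable_perm //.
  by rewrite sV // inE zF orbT.
Qed.

Lemma card_inverters_extension E F r : stable E -> stable F ->
    [disjoint E & F] -> r \in inverters E ->
  #|[set s in inverters (E :|: F) | [forall z in E, s z == r z]]| =
    #|inverters F|.
Proof.
move=> stE stF disjEF rE.
have /invertersP[r_on /mulg_involutive rK _] := rE.
rewrite -[RHS](card_imset _ (mulgI r)); apply: eq_card => s.
rewrite inE; apply/andP/imsetP => [[sEF /forall_inP eq_sr] | [t tF ->]].
  exists (r * s); last by rewrite rK.
  by apply: inverters_restr sEF _ => // z /eq_sr /eqP.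
split; first exact: invertersM.
have /invertersP[t_on _ _] := tF.
apply/forall_inP => z zE; rewrite permM (out_perm t_on) //.
by rewrite (disjointFr disjEF) // (perm_closed _ r_on).
Qed.

(* Exchanges [g x] and [g^-1 y] for [g] in [<[rho]>], which is a reflection of
   the cycle of [x] if [y] lies on it.  The value is independent of the picked
   [g] when the cycles of [x] and [y] have the same length. *)
Definition porbit_reflection x y z : T :=
  if [pick g in <[rho]> | g x == z] is Some g then g^-1 y
  else if [pick g in <[rho]> | g y == z] is Some g then g^-1 x
  else z.

Section Reflection.
Variables x y : T.
Hypothesis eq_xy : #|porbit rho x| = #|porbit rho y|.

Lemma porbit_reflectionl g :
  g \in <[rho]> -> porbit_reflection x y (g x) = g^-1 y.
Proof.
move=> Gg; rewrite /porbit_reflection; case: pickP => [h /andP[Gh /eqP] |].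
  exact: eq_cycleV_porbit.
by move/(_ g); rewrite Gg eqxx.
Qed.

Lemma porbit_reflectionr g :
  g \in <[rho]> -> porbit_reflection x y (g y) = g^-1 x.
Proof.
move=> Gg; rewrite /porbit_reflection; case: pickP => [h /andP[Gh /eqP hx] | _].
  rewrite -{1}[y](permK g) -hx -!permM; congr (fun_of_perm _ x).
  by rewrite (centsP (cycle_abelian rho) h Gh) ?groupM ?groupV // mulgKV.
case: pickP => [h /andP[Gh /eqP] |].
  by apply: eq_cycleV_porbit; first exact: esym.
by move/(_ g); rewrite Gg eqxx.
Qed.

Lemma porbit_reflection_out z :
  z \notin porbit rho x :|: porbit rho y -> porbit_reflection x y z = z.
Proof.
rewrite !inE => /norP[x'z y'z]; rewrite /porbit_reflection.
case: pickP => [g /andP[Gg /eqP gx] | _].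
  by case/porbit_cycleP: x'z; exists g.
case: pickP => [g /andP[Gg /eqP gy] | //].
by case/porbit_cycleP: y'z; exists g.
Qed.

Lemma porbit_reflectionK : involutive (porbit_reflection x y).
Proof.
move=> z; have [|zE] := boolP (z \in porbit rho x :|: porbit rho y); last first.
  by rewrite !porbit_reflection_out.
case/setUP=> /porbit_cycleP[g Gg ->].
  by rewrite porbit_reflectionl // porbit_reflectionr ?groupV // invgK.
by rewrite porbit_reflectionr // porbit_reflectionl ?groupV // invgK.
Qed.

Lemma exists_inverter_exchanging :
  exists2 r, r \in inverters (porbit rho x :|: porbit rho y) & r x = y.
Proof.
pose r := perm (inv_inj porbit_reflectionK).
have r_def z : r z = porbit_reflection x y z by rewrite permE.
have r_cyclel g : g \in <[rho]> -> r (g x) = g^-1 y.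
  by rewrite r_def; apply: porbit_reflectionl.
have r_cycler g : g \in <[rho]> -> r (g y) = g^-1 x.
  by rewrite r_def; apply: porbit_reflectionr.
have commV g : g \in <[rho]> -> (g * rho)^-1 = g^-1 * rho^-1.
  by move=> /cycleP[i ->]; rewrite -expgSr expgS invMg.
have Grho := cycle_id rho.
exists r; last by rewrite -{1}[x]perm1 r_cyclel // invg1 perm1.
apply/invertersP; split.
- apply/subsetP => z; apply: contraR => zE.
  by rewrite r_def porbit_reflection_out.
- apply/permP => z; rewrite expgS expg1 permM perm1 !r_def.
  exact: porbit_reflectionK.
- move=> _ /setUP[] /porbit_cycleP[g Gg ->]; rewrite -[rho _]permM.
    by rewrite !r_cyclel ?groupM // commV // permM.
  by rewrite !r_cycler ?groupM // commV // permM.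
Qed.

End Reflection.

Lemma card_inverters_fibre D x y : stable D -> x \in D -> y \in D ->
    #|porbit rho x| = #|porbit rho y| ->
  #|[set s in inverters D | s x == y]| =
    #|inverters (D :\: (porbit rho x :|: porbit rho y))|.
Proof.
move=> stD xD yD eq_xy; set E := _ :|: _; set F := D :\: E.
have [r rE rx] := exists_inverter_exchanging eq_xy.
have stE : stable E by rewrite actsU ?stable_porbit.
have defD : E :|: F = D.
  by rewrite -[RHS](setID D E) (setIidPr _) // subUset !porbit_sub // xD.
have xE : x \in E by rewrite inE porbit_id.
have disjEF : [disjoint E & F].
  by rewrite disjoint_sym -setI_eq0 setIDAC setD_eq0 subsetIr.
rewrite -(card_inverters_extension stE (actsD stD stE) disjEF rE) defD.
apply: eq_card => s; rewrite [LHS]inE [RHS]inE; apply: andb_id2l => sD.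
apply/eqP/forall_inP => [sx z zE | /(_ x xE) /eqP-> //].
have rx_sx : r x = s x by rewrite rx sx.
by rewrite (eq_in_inverters stD stE rE sD xE xD rx_sx) // sx.
Qed.

Local Close Scope group_scope.

Lemma card_inverters_sum D x : stable D -> x \in D ->
  #|inverters D| =
    \sum_(y in D | #|porbit rho y| == #|porbit rho x|)
      #|inverters (D :\: (porbit rho x :|: porbit rho y))|.
Proof.
move=> stD xD.
pose same_size := [pred y in D | #|porbit rho y| == #|porbit rho x|].
rewrite -sum1_card (partition_big (fun s : {perm T} => s x) same_size) /=.
  apply: eq_bigr => y /andP[yD /eqP eq_yx].
  rewrite -(card_inverters_fibre stD xD yD) // -sum1_card.
  by apply: eq_bigl => s; rewrite !inE.
move=> s sD; have [s_on _ _] := invertersP _ _ sD.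
by rewrite (perm_closed _ s_on) xD (card_porbit_inverters stD sD) /=.
Qed.

Lemma card_inverters_rec D x : stable D -> x \in D ->
  #|inverters D| =
    #|porbit rho x| * #|inverters (D :\: porbit rho x)| +
    \sum_(y in D :\: porbit rho x | #|porbit rho y| == #|porbit rho x|)
      #|inverters (D :\: porbit rho x :\: porbit rho y)|.
Proof.
move=> stD xD; rewrite (card_inverters_sum stD xD).
rewrite (bigID (mem (porbit rho x))) /= -sum_nat_const; congr (_ + _).
  apply: eq_big => [y | y /andP[_]].
    have [yx | _] := boolP (y \in porbit rho x); last by rewrite andbF.
    have /eqP-> : porbit rho y == porbit rho x by rewrite eq_porbit_mem.
    by rewrite (subsetP _ y yx) ?porbit_sub ?eqxx.
  by rewrite -eq_porbit_mem => /eqP->; rewrite setUid.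
apply: eq_big => [y | y _]; last by rewrite setDDl.
by rewrite inE andbC andbA.
Qed.

Definition porbit_count D k : nat :=
  #|[set C in porbit rho @: D | #|C| == k]|.

Lemma imset_porbitD D x :
  porbit rho @: (D :\: porbit rho x) = porbit rho @: D :\ porbit rho x.
Proof.
apply/setP => C; apply/imsetP/setD1P => [[y /setDP[yD x'y] ->] | [neCx]].
  by rewrite eq_porbit_mem imset_f.
case/imsetP=> y yD C_y; exists y; rewrite // inE yD andbT.
by rewrite -eq_porbit_mem -C_y.
Qed.

Lemma porbit_countD D x k : x \in D ->
  porbit_count D k =
    porbit_count (D :\: porbit rho x) k + (k == #|porbit rho x|).
Proof.
move=> xD; rewrite /porbit_count imset_porbitD.
rewrite (cardsD1 (porbit rho x)) inE imset_f // addnC eq_sym.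
by congr (_ + _); apply: eq_card => C; rewrite !inE andbA.
Qed.

Lemma card_porbit_size D k : stable D ->
  #|[set y in D | #|porbit rho y| == k]| = porbit_count D k * k.
Proof.
move=> stD; set S := [set y in D | _].
have stS : stable S.
  apply/actsP => g Gg y; rewrite !inE (acts_act stD Gg).
  suff /eqP-> : porbit rho (g y) == porbit rho y by [].
  by rewrite eq_porbit_mem; apply/porbit_cycleP; exists g.
have -> : porbit_count D k = #|porbit rho @: S|.
  apply: eq_card => C; rewrite inE.
  apply/andP/imsetP => [[/imsetP[y yD ->] ky] | [y /setIdP[yD ky] ->]].
    by exists y; rewrite // inE yD.
  by rewrite imset_f.
apply: card_uniform_partition; last by rewrite porbitE orbit_partition.
by move=> _ /imsetP[y /setIdP[_ /eqP ky] ->].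
Qed.

Lemma card_inverters D : stable D ->
  #|inverters D| = \prod_(1 <= k < #|T|.+1) Rsumn (porbit_count D k) k.
Proof.
have [n] := ubnP #|D|; elim: n => // n IHn in D *; rewrite ltnS => leDn stD.
have [-> | [x xD]] := set_0Vmem D.
  rewrite inverters0 cards1 big1 // => k _; rewrite /porbit_count imset0.
  by rewrite setIdE set0I cards0 Rsumn0.
set k := #|porbit rho x|; set D' := D :\: porbit rho x.
have stD' : stable D' by rewrite actsD ?stable_porbit.
have ltD'n : #|D'| < n.
  apply: leq_trans leDn; apply: proper_card; apply/properP.
  by split; [exact: subsetDl | exists x; rewrite // inE porbit_id].
have k_range : 0 < k <= #|T| by rewrite lt0n card_porbit_neq0 max_card.
under eq_bigr => i _ do rewrite (porbit_countD i xD).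
rewrite prod_Rsumn_rec // mulnDr (card_inverters_rec stD xD) -/k -/D'.
rewrite (IHn D') //; congr (_ + _).
have count_del y : y \in D' -> #|porbit rho y| = k -> forall i,
    porbit_count (D' :\: porbit rho y) i = porbit_count D' i - (i == k).
  by move=> yD' ky i; rewrite (porbit_countD i yD') ky addnK.
under eq_bigr => y /andP[yD' /eqP ky].
  rewrite IHn ?actsD ?stable_porbit //; last first.
    by apply: leq_ltn_trans ltD'n; rewrite subset_leq_card ?subsetDl.
  under eq_bigr => i _ do rewrite (count_del y) //.
  over.
by rewrite sum_nat_const mulnA [k * _]mulnC -card_porbit_size // cardsE.
Qed.

Lemma count_cycle_type k :
  count_mem k (cycle_type rho) = porbit_count setT k.
Proof.
rewrite /cycle_type (seq.permP (permEl (perm_sort _ _))) count_map -sum1_count.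
rewrite big_enum_cond /porbit_count -sum1_card; apply: eq_bigl => C.
by rewrite inE /=; congr (_ && _); apply/imsetP/imsetP => -[x _ ->]; exists x.
Qed.

Lemma card_invertersT :
  #|inverters setT| =
    \prod_(1 <= k < #|T|.+1) Rsumn (count_mem k (cycle_type rho)) k.
Proof.
rewrite card_inverters; last by apply/actsP => g _ x; rewrite !inE.
by apply: eq_bigr => k _; rewrite count_cycle_type.
Qed.

End Inverters.

Lemma card_involution_factorizations n (rho : 'S_n) :
  #|involution_factorizations rho| = #|inverters rho setT|.
Proof.
have pair_inj : injective (fun s => (s, s * rho)%g) by move=> s t [].
rewrite -[RHS](card_imset _ pair_inj); apply: eq_card => -[s t].
rewrite inE.
apply/and3P/imsetP => /= [[/eqP s2 /eqP t2 /eqP st] | [u + [-> ->]]].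
  have t_def : t = (s * rho)%g by rewrite -st mulg_involutive.
  by exists s; rewrite ?t_def // mem_invertersT s2 -t_def t2 !eqxx.
rewrite mem_invertersT => /andP[u2 urho2]; split=> //.
by rewrite (mulg_involutive (eqP u2)).
Qed.

Theorem theorem2p1 (n : nat) (n_ge1 : (1 <= n)%N)
    (lam : seq nat) (lam_part : is_partition_of n lam)
    (rho : 'S_n) (rho_type : cycle_type rho = lam) :
  (#|involution_factorizations rho|%:R =
     \prod_(1 <= i < n.+1) Rsum (count_mem i lam) i)%R.
Proof.
rewrite card_involution_factorizations card_invertersT.
rewrite card_ord rho_type natr_prod.
by apply: eq_bigr => i _; rewrite natr_Rsumn.
Qed.
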